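(* Let $A\in\mathbb{R}^{n\times n}$ be a (symmetric) positive semi-definite matrix. Then \[ \rho_{\mathrm{per}}(A)+\eta_{\mathrm{per}}(A)=n . \]
   Context: For an $m\times m$ matrix $B$, $\mathrm{per}(B)=\sum_{\sigma\in S_m}\prod_i b_{i,\sigma(i)}$. The permanental rank $\rho_{\mathrm{per}}(A)$ is the largest $k$ such that some $k\times k$ submatrix $A[I,J]$ (rows $I$, columns $J$, $|I|=|J|=k$) has nonzero permanent; the permanental nullity $\eta_{\mathrm{per}}(A)$ is the multiplicity of $0$ as a root of the permanental polynomial $\pi(A,x)=\mathrm{per}(A-xI)$. *)

(* Defs.v *)
From mathcomp Require Import all_boot all_order all_algebra all_fingroup reals.

Set Implicit Arguments.
Unset Strict Implicit.
Unset Printing Implicit Defensive.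

Import GRing.Theory Num.Theory.
Local Open Scope ring_scope.

Definition per (S : comNzRingType) (m : nat) (B : 'M[S]_m) : S :=
  \sum_(s : 'S_m) \prod_(i < m) B i (s i).

Definition ksubset (n k : nat) := {I : {set 'I_n} | #|I| == k}.

Definition ksubset_idx (n k : nat) (I : ksubset n k) (i : 'I_k) : 'I_n :=
  enum_val (cast_ord (esym (eqP (valP I))) i).

(* A[I,J], rows and columns being kept in increasing order. *)
Definition ksubmx (T : Type) (n k : nat) (A : 'M[T]_n) (I J : ksubset n k) :
    'M[T]_k :=
  mxsub (ksubset_idx I) (ksubset_idx J) A.

(* The maximum is over a nonempty set: k = 0 always qualifies, since the empty
   permanent is 1. *)
Definition per_rank (S : comNzRingType) (n : nat) (A : 'M[S]_n) : nat :=
  \max_(k < n.+1 |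
    [exists I : ksubset n k, exists J : ksubset n k, per (ksubmx A I J) != 0]) k.

Definition per_poly (S : comNzRingType) (n : nat) (A : 'M[S]_n) : {poly S} :=
  per (map_mx polyC A - 'X%:M).

Definition per_nullity (F : fieldType) (n : nat) (A : 'M[F]_n) : nat :=
  mup 0 (per_poly A).

Definition psdmx (R : realFieldType) (n : nat) (A : 'M[R]_n) : Prop :=
  A^T = A /\ forall x : 'cV[R]_n, 0 <= (x^T *m A *m x) 0 0.

(* Main.v *)
Require Import Defs.
From mathcomp Require Import all_boot all_order all_algebra all_fingroup reals.
From mathcomp Require Import ring lra.

(* Write the positive semi-definite matrix as A = V^T V. A permanental
   Cauchy-Binet formula expresses k! per(A[I,J]) as the sum over all
   f : [k] -> [n] of per(V[f,I]) per(V[f,J]). Hence per(A[I,I]) >= 0, with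
   equality only if all per(V[f,I]) vanish, and then per(A[I,J]) = 0 for every
   J: the permanental rank is attained on a principal submatrix. The coefficient
   of x^(n-k) in per(A - x I) is, up to sign, the sum of the principal
   permanents of size k; as these are nonnegative they do not cancel, so the
   lowest nonzero coefficient sits at x^(n - rank). *)

Set Implicit Arguments.
Unset Strict Implicit.
Unset Printing Implicit Defensive.

Import GRing.Theory Num.Theory.
Local Open Scope ring_scope.

Lemma per_rowsub_perm (S : comNzRingType) (m k : nat) (Z : 'M[S]_(m, k))
    (f : 'I_k -> 'I_m) (t : 'S_k) :
  per (rowsub (f \o t) Z) = per (rowsub f Z).
Proof.
rewrite /per [RHS](reindex_inj (mulgI t^-1%g)) /=.
apply: eq_bigr => s _; rewrite [RHS](reindex_inj (@perm_inj _ t)) /=.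
by apply: eq_bigr => i _; rewrite !mxE permM permK.
Qed.

(** Expand each entry of the product and distribute the product over these sums: [f] records the
    summation index chosen at each row. *)
Lemma per_mul_trmx (S : comNzRingType) (m k : nat) (W Z : 'M[S]_(m, k)) :
  per (W^T *m Z) =
  \sum_(f : {ffun 'I_k -> 'I_m}) (\prod_i W (f i) i) * per (rowsub f Z).
Proof.
transitivity (\sum_(s : 'S_k) \sum_(f : {ffun 'I_k -> 'I_m})
    \prod_i (W (f i) i * Z (f i) (s i))).
  apply: eq_bigr => s _.
  rewrite -(bigA_distr_bigA (fun i l => W l i * Z l (s i))).
  apply: eq_bigr => i _; rewrite mxE.
  by apply: eq_bigr => l _; rewrite !mxE.
rewrite exchange_big; apply: eq_bigr => f _.
rewrite mulr_sumr; apply: eq_bigr => s _; rewrite -big_split /=.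
by apply: eq_bigr => i _; rewrite !mxE.
Qed.

(** Expanding [per (rowsub f W)] over [t] gives [k!] sums over [f], each equal to [per (W^T *m Z)].
    Letting [f] run over all functions, not multisets of rows, avoids dividing by multiplicities. *)
Lemma per_cauchy_binet (S : comNzRingType) (m k : nat) (W Z : 'M[S]_(m, k)) :
  per (W^T *m Z) *+ k`! =
  \sum_(f : {ffun 'I_k -> 'I_m}) per (rowsub f W) * per (rowsub f Z).
Proof.
under [RHS]eq_bigr => f _ do rewrite {1}/per mulr_suml.
rewrite exchange_big -card_Sn -sumr_const /=.
apply: eq_big => [s|t _]; first by rewrite inE.
(* Precomposing [f] with [t] turns the weight of [t] into that of the identity and leaves
   [per (rowsub f Z)] unchanged. *)
pose h (u : 'S_k) (f : {ffun 'I_k -> 'I_m}) := [ffun i => f (u i)].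
have h_bij : bijective (h t).
  by exists (h t^-1%g) => f; apply/ffunP => i; rewrite !ffunE ?permK ?permKV.
rewrite per_mul_trmx [RHS](reindex (h t)) /=; last exact: onW_bij.
apply: eq_bigr => f _; congr (_ * _).
  rewrite (reindex_inj (@perm_inj _ t)) /=.
  by apply: eq_bigr => i _; rewrite mxE ffunE.
rewrite -(per_rowsub_perm Z f t); congr per.
by apply/matrixP => i j; rewrite !mxE ffunE.
Qed.

Section Gram.
Variables (R : realFieldType) (m k : nat).
Implicit Types W Z : 'M[R]_(m, k).

Lemma per_gram_ge0 W : 0 <= per (W^T *m W).
Proof.
rewrite -(pmulrn_lge0 _ (fact_gt0 k)) per_cauchy_binet.
by apply: sumr_ge0 => f _; rewrite -expr2 sqr_ge0.
Qed.

Lemma per_gram_eq0 W Z : per (W^T *m W) = 0 -> per (W^T *m Z) = 0.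
Proof.
move=> W0; have := per_cauchy_binet W W; rewrite W0 mul0rn => /esym.
move=> /psumr_eq0P H.
have Wf0 (f : {ffun 'I_k -> 'I_m}) : per (rowsub f W) = 0.
  apply/eqP; rewrite -sqrf_eq0 expr2; apply/eqP.
  by apply: H => // g _; rewrite -expr2 sqr_ge0.
have /eqP : per (W^T *m Z) *+ k`! = 0.
  by rewrite per_cauchy_binet big1 // => f _; rewrite Wf0 mul0r.
by rewrite mulrn_eq0 eqn0Ngt fact_gt0 /= => /eqP.
Qed.
End Gram.

(** Cholesky factorisation, by induction on the Schur complement of the leading entry; the real
    closed field supplies its square root. *)
Lemma psd_gram (R : rcfType) (n : nat) (A : 'M[R]_n) :
  psdmx A -> exists V : 'M[R]_n, A = V^T *m V.
Proof.
elim: n A => [A _|n IHn]; first by exists A; apply/matrixP => -[].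
rewrite -[n.+1]/(1 + n)%N => A [symA psdA].
pose a := A 0 0; pose b := ursubmx A; pose C := drsubmx A.
have defA : A = block_mx a%:M b b^T C.
  rewrite -[A in LHS]submxK; congr block_mx.
    by apply/matrixP => i j; rewrite !ord1 !mxE !lshift0.
  by rewrite -[A in LHS]symA -trmx_ursub.
have trC : C^T = C by rewrite /C trmx_drsub symA.
have quad (t : R) (y : 'cV[R]_n) :
    0 <= t ^+ 2 * a + (t * (b *m y) 0 0) *+ 2 + (y^T *m C *m y) 0 0.
  have := psdA (col_mx t%:M y).
  rewrite [A in _ *m A *m _]defA tr_col_mx mul_row_block mul_row_col.
  rewrite tr_scalar_mx !mul_scalar_mx !mul_mx_scalar !mulmxDl.
  rewrite -trmx_mul scalerDr -!scalemxAl scale_scalar_mx.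
  by rewrite !mxE !eqxx !mulr1n; congr (_ <= _); ring.
have a_ge0 : 0 <= a.
  by have := quad 1 0; rewrite !mulmx0 !mxE; lra.
have b0 : a = 0 -> b = 0.
  move=> a0; apply/rowP => j; rewrite [RHS]mxE; apply: contraTeq isT => bj.
  pose y : 'cV[R]_n := delta_mx j 0; pose q := (y^T *m C *m y) 0 0.
  (* For [a = 0] the form is affine in [t]; this [t] gives it the value -1. *)
  have := quad (- (q + 1) / (b 0 j *+ 2)) y.
  rewrite a0 mulr0 add0r -/q -colE [col _ _ _ _]mxE -mulrnAr.
  by rewrite divfK ?mulrn_eq0 //; lra.
(* If [a = 0] then [a^-1 = 0] as well, so the Schur complement is just [C]. *)
have [W defW] : exists W : 'M[R]_n, C - a^-1 *: (b^T *m b) = W^T *m W.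
  apply: IHn; split=> [|y].
    by rewrite linearB linearZ /= trmx_mul trmxK trC.
  have -> : (y^T *m (C - a^-1 *: (b^T *m b)) *m y) 0 0 =
      (y^T *m C *m y) 0 0 - a^-1 * (b *m y) 0 0 ^+ 2.
    rewrite mulmxBr mulmxBl -scalemxAr -scalemxAl mulmxA -trmx_mul.
    rewrite -[_^T *m b *m y]mulmxA; set z := b *m y.
    rewrite mxE; congr (_ + _).
    by rewrite !mxE big_ord1 !mxE expr2.
  have [a0|a_neq0] := eqVneq a 0.
    by have := quad 0 y; rewrite (b0 a0) mul0mx !mxE; lra.
  (* This [t] minimises the form for fixed [y]; the minimum is the form of the Schur complement. *)
  have := quad (- (b *m y) 0 0 / a) y; congr (_ <= _).
  by field.
pose s := Num.sqrt a; have s2 : s * s = a by rewrite -expr2 sqr_sqrtr.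
(* If [s = 0] the scalar is 0, not 1, but then [b = 0]. *)
have sb : (s * s^-1) *: b = b.
  have [s0|s_neq0] := eqVneq s 0; last by rewrite divff // scale1r.
  by rewrite b0 ?scaler0 // -s2 s0 mul0r.
exists (block_mx s%:M (s^-1 *: b) 0 W).
rewrite defA tr_block_mx mulmx_block !trmx0 !mul0mx !addr0 mulmx0 addr0.
rewrite tr_scalar_mx -scalar_mxM s2 -defW mul_scalar_mx mul_mx_scalar.
have trb : (s^-1 *: b)^T = s^-1 *: b^T by rewrite linearZ.
have sbT : (s * s^-1) *: b^T = b^T by rewrite -[in RHS]sb linearZ.
rewrite trb -scalemxAl -scalemxAr !scalerA sbT sb.
by rewrite -invfM s2 addrC subrK.
Qed.

(** This is the permanent of [A[J,J]], written with permutations of all of ['I_n] so that it matches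
    the terms of [per_poly]. *)
Definition principal_per (S : comNzRingType) (n : nat) (A : 'M[S]_n)
    (J : {set 'I_n}) : S :=
  \sum_(s : 'S_n | perm_on J s) \prod_(i in J) A i (s i).

Lemma ksubset_idx_inj (n k : nat) (I : ksubset n k) :
  injective (ksubset_idx I).
Proof. by move=> i j /enum_val_inj /cast_ord_inj. Qed.

Lemma ksubset_idx_in (n k : nat) (I : ksubset n k) (i : 'I_k) :
  ksubset_idx I i \in val I.
Proof. exact: enum_valP. Qed.

Lemma ksubset_idx_onto (n k : nat) (I : ksubset n k) :
  [set ksubset_idx I i | i in 'I_k] = val I.
Proof.
apply/eqP; rewrite eqEcard; apply/andP; split.
  by apply/subsetP => _ /imsetP[i _ ->]; apply: ksubset_idx_in.
by rewrite card_imset ?card_ord ?(eqP (valP I)) //; apply: ksubset_idx_inj.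
Qed.

(** A permutation of ['I_k], carried to [I] by the enumeration and extended by the identity, gives
    one supported on [I]. *)
Lemma per_ksubmx (S : comNzRingType) (n k : nat) (A : 'M[S]_n)
    (I : ksubset n k) :
  per (ksubmx A I I) = principal_per A (val I).
Proof.
pose e := ksubset_idx I; have e_inj : injective e := @ksubset_idx_inj _ _ I.
have eI i : e i \in val I := ksubset_idx_in I i.
pose h0 (s : 'S_k) x := if [pick i | e i == x] is Some i then e (s i) else x.
have h0e s i : h0 s (e i) = e (s i).
  rewrite /h0; case: pickP => [j /eqP/e_inj -> //|/(_ i)].
  by rewrite eqxx.
have h0out s x : x \notin val I -> h0 s x = x.
  rewrite /h0; case: pickP => [j /eqP <-|//].
  by rewrite eI.
have inI x : x \in val I -> exists i, x = e i.
  by rewrite -ksubset_idx_onto => /imsetP[i _ ->]; exists i.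
have h0_inj s : injective (h0 s).
  have h0I x : (h0 s x \in val I) = (x \in val I).
    have [/inI[i ->]|xI] := boolP (x \in val I); first by rewrite h0e eI.
    by rewrite h0out ?(negPf xI).
  move=> x y exy; have := congr1 (mem (val I)) exy; rewrite /= !h0I.
  have [/inI[i ex] /esym/inI[j ey]|xI /esym/negbT yI] := boolP (x \in val I).
    by move: exy; rewrite ex ey !h0e => /e_inj/perm_inj ->.
  by move: exy; rewrite !h0out.
pose h s : 'S_n := perm (@h0_inj s).
have he s i : h s (e i) = e (s i) by rewrite permE h0e.
have h_inj : injective h.
  by move=> s t est; apply/permP => i; apply: e_inj; rewrite -!he est.
(* Both sets have [k!] elements, so one inclusion suffices. *)
have imh : [set h s | s in 'S_k] = [set s | perm_on (val I) s].
  apply/eqP; rewrite eqEcard card_imset // cardsE card_perm (eqP (valP I)).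
  rewrite card_Sn leqnn andbT.
  apply/subsetP => _ /imsetP[s _ ->]; rewrite inE; apply/subsetP => x.
  by rewrite inE permE; apply: contraR => /h0out ->.
rewrite /principal_per (eq_bigl (mem [set h s | s in 'S_k])); last first.
  by move=> s; rewrite imh /= inE.
rewrite big_imset /=; last by move=> s t _ _; apply: h_inj.
apply: eq_bigr => s _.
rewrite -ksubset_idx_onto big_imset /=; last by move=> i j _ _; apply: e_inj.
by apply: eq_bigr => i _; rewrite mxE he.
Qed.

(** Expand each product over [i], with [J] the set of indices where the entry of [A] is taken rather
    than that of [- 'X%:M]. *)
Lemma per_poly_principal (S : comNzRingType) (n : nat) (A : 'M[S]_n) :
  per_poly A =
  \sum_(J : {set 'I_n}) (principal_per A J)%:P * (- 'X) ^+ (n - #|J|).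
Proof.
rewrite /per_poly /per.
transitivity (\sum_(s : 'S_n) \sum_(J : {set 'I_n})
    \prod_i if i \in J then (A i (s i))%:P else - 'X *+ (i == s i)).
  apply: eq_bigr => s _; rewrite -bigA_distr; apply: eq_bigr => i _.
  by rewrite !mxE mulNrn.
rewrite exchange_big; apply: eq_bigr => J _ /=.
rewrite rmorph_sum /= mulr_suml [LHS](bigID (perm_on J)) /= addrC big1 ?add0r.
  apply: eq_bigr => s sJ.
  rewrite (bigID (mem J)) /= rmorph_prod /=; congr (_ * _).
    by apply: eq_bigr => i ->.
  transitivity (\prod_(i in ~: J) - 'X : {poly S}).
    apply: eq_big => [i|i iJ]; first by rewrite inE.
    by rewrite (negPf iJ) (out_perm sJ iJ) eqxx mulr1n.
  by rewrite prodr_const cardsCs setCK card_ord.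
(* Here [s] moves some [i] outside [J], where the factor is an off-diagonal entry of [- 'X%:M],
   hence 0. *)
move=> s /subsetPn[i si iJ]; rewrite (bigD1 i) //= (negPf iJ).
by move: si; rewrite inE eq_sym => /negPf ->; rewrite mulr0n mul0r.
Qed.

(** Every surviving term contains [(- 'X) ^+ (n - r)]; the cofactor [q] takes at 0 the value of the
    sum over sets of size [r]. *)
Lemma mup_per_poly (F : fieldType) (n r : nat) (A : 'M[F]_n) :
    (r <= n)%N ->
    (forall J : {set 'I_n}, (r < #|J|)%N -> principal_per A J = 0) ->
    \sum_(J : {set 'I_n} | #|J| == r) principal_per A J != 0 ->
  mup 0 (per_poly A) = (n - r)%N.
Proof.
move=> rn hi cr.
pose q := \sum_(J : {set 'I_n} | (#|J| <= r)%N)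
  (principal_per A J)%:P * (- 'X) ^+ (r - #|J|).
have -> : per_poly A = (- 'X) ^+ (n - r) * q.
  rewrite per_poly_principal (bigID (fun J : {set 'I_n} => #|J| <= r)%N) /=.
  rewrite [X in _ + X]big1 ?addr0 => [|J]; last first.
    by rewrite -ltnNge => /hi ->; rewrite mul0r.
  rewrite mulr_sumr; apply: eq_bigr => J Jr.
  by rewrite mulrCA -exprD addnBA // subnK.
rewrite exprNn -[_ ^+ _ * _ * q]mulrA mupMr; last first.
  by rewrite rootE -signr_odd; case: odd; rewrite !hornerE ?oppr_eq0 oner_eq0.
rewrite mupMl; first by rewrite -['X]subr0 -polyC0 mup_XsubCX eqxx.
rewrite rootE horner_sum (bigID (fun J : {set 'I_n} => #|J| == r)) /=.
rewrite [X in _ + X]big1 ?addr0 => [|J /andP[Jr nJ]]; last first.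
  rewrite !hornerE -[(r - _)%N]prednK ?subn_gt0 ?ltn_neqAle ?nJ //.
  by rewrite exprS mulrCA mulNr mul0r oppr0.
rewrite (eq_bigl (fun J : {set 'I_n} => #|J| == r)) => [|J]; last first.
  by case: eqP => [->|]; rewrite ?leqnn ?andbF.
rewrite (eq_bigr (principal_per A)) // => J /eqP ->.
by rewrite subnn expr0 mulr1 hornerC.
Qed.

Theorem theorem5 (R : realType) (n : nat) (A : 'M[R]_n) (hA : psdmx A) :
  (per_rank A + per_nullity A)%N = n.
Proof.
have [V defA] := psd_gram hA.
have gramA k (I J : ksubset n k) : ksubmx A I J =
    (colsub (ksubset_idx I) V)^T *m colsub (ksubset_idx J) V.
  by rewrite /ksubmx defA mxsub_mul trmx_mxsub.
pose P (k : 'I_n.+1) := [exists I : ksubset n k, exists J : ksubset n k,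
  per (ksubmx A I J) != 0].
have principal_ge0 J : 0 <= principal_per A J.
  by rewrite -(per_ksubmx A (Sub J (eqxx #|J|))) gramA per_gram_ge0.
have P0 : (0 < #|P|)%N.
  have h0 : #|@set0 'I_n| == 0%N by rewrite cards0.
  apply/card_gt0P; exists ord0; apply/existsP; exists (Sub set0 h0).
  apply/existsP; exists (Sub set0 h0); rewrite /per.
  under eq_bigr do rewrite big_ord0.
  by rewrite sumr_const card_Sn fact0 oner_eq0.
have [r Pr rankA] := eq_bigmax_cond (fun k : 'I_n.+1 => k : nat) P0.
have {}rankA : per_rank A = r by [].
have rn : (r <= n)%N by rewrite -ltnS.
rewrite rankA /per_nullity (@mup_per_poly _ _ r) ?subnKC //.
(* By contraposition: a nonzero principal permanent makes [#|J|] a candidate in the maximum, so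
   [#|J|] is at most [r]. *)
- move=> J rJ; apply/eqP; apply: contraTT rJ => J0; rewrite -leqNgt -rankA.
  have Jn : (#|J| < n.+1)%N by rewrite ltnS -[n in (_ <= n)%N]card_ord max_card.
  apply: (@leq_bigmax_cond _ _ _ (Ordinal Jn)).
  apply/existsP; exists (Sub J (eqxx #|J|)).
  by apply/existsP; exists (Sub J (eqxx #|J|)); rewrite per_ksubmx.
- case/existsP: Pr => I /existsP[J IJ].
  (* If the sum were 0, each nonnegative term would be 0, including that of [I], which forces
     [per (ksubmx A I J) = 0]. *)
  apply: contra IJ => /eqP/psumr_eq0P c0.
  rewrite gramA per_gram_eq0 // -gramA per_ksubmx; apply: c0 => //.
  exact: valP I.
Qed.
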